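(* Let $K\in\mathbb{N}_0$, let $S=(S_t)_{0\le t\le K}$ be a strictly positive adapted process, and let $\psi=(\psi_0,\ldots,\psi_K)$ be a family of operators $\psi_0,\ldots,\psi_{K-1}$ and a random variable $\psi_K$ satisfying (P1)–(P4) of the context. For an adapted process $X=(X_k)_{k=0,\ldots,K}$ let $A=(A_t)_{0\le t\le K}$ denote the associated money account with consumption. Then $X$ is non-negative and fulfills $$X_k=\psi_k(X_{k+1}),\quad k=0,\ldots,K-1,\qquad\text{and}\qquad X_K=\psi_K A_K$$ if and only if $$X_k=Z_kA_k,\quad k=0,\ldots,K,$$ where the process $(Z_k)_{k=0,\ldots,K}$ is defined by the backward recursion $$Z_K=\psi_K,\qquad Z_{k-1}=\frac{\psi_{k-1}(Z_kS_k)}{S_{k-1}+\psi_{k-1}(Z_kS_k)},\quad k=1,\ldots,K .$$ Furthermore, the process $X$ uniquely determined in this way is a regular consumption process with respect to $S$.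
   Context: Let $(\Omega,\mathcal{F},\mathbb{P})$ be a probability space with a filtration $(\mathcal{F}_t)_{0\le t\le K}$, $K\in\mathbb{N}_0$. $S=(S_t)_{0\le t\le K}$ is a strictly positive real-valued process adapted to $(\mathcal{F}_t)$ (money account without consumption). A consumption process is a real-valued process $X=(X_k)_{k=0,\ldots,K}$ adapted to $(\mathcal{F}_k)_{k=0,\ldots,K}$. The money account with consumption $A=(A_t)_{0\le t\le K}$ associated with $S$ and $X$ is defined by $A_0=S_0$ and $A_t=(A_k-X_k)S_t/S_k$ for $k<t\le k+1$, $k=0,\ldots,K-1$. $X$ is called regular with respect to $S$ if $0\le X_k\le A_k$ for $k=0,\ldots,K$. Equalities and inequalities between random variables are understood pointwise. $L^0(\mathcal{F}_k)$ denotes the set of real-valued $\mathcal{F}_k$-measurable random variables, and $L^0_+(\mathcal{F}_k)$, $L^0_-(\mathcal{F}_k)$ the subsets of non-negative, respectively non-positive, ones. The properties required of $\psi$ are: (P1) for $k=0,\ldots,K-1$, $\psi_k$ is a mapping $L^0(\mathcal{F}_{k+1})\to L^0(\mathcal{F}_k)$ (not necessarily linear); (P2) $\psi_k$ maps $L^0_+(\mathcal{F}_{k+1})$ into $L^0_+(\mathcal{F}_k)$ and $L^0_-(\mathcal{F}_{k+1})$ into $L^0_-(\mathcal{F}_k)$; (P3) $\psi_k(YX)=Y\psi_k(X)$ for all $X\in L^0(\mathcal{F}_{k+1})$ and $Y\in L^0_+(\mathcal{F}_k)$; (P4) $\psi_K\in L^0_+(\mathcal{F}_K)$ is a random variable with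 $\psi_K\le 1$. *)

(* Defs.v *)
From mathcomp Require Export all_boot all_order all_algebra.
From mathcomp Require Export all_classical all_reals all_analysis.
Export Order.TTheory GRing.Theory Num.Theory.
Export numFieldNormedType.Exports.

Set Implicit Arguments.
Unset Strict Implicit.
Unset Printing Implicit Defensive.

Local Open Scope classical_set_scope.
Local Open Scope ring_scope.

(* Continuous time is a real t with 0 <= t <= K%:R, discrete time a natural
   number k <= K; the values of the families below at other times are never
   used.  The integer date k is the real time k%:R. *)
Definition filtration d (T : measurableType d) (R : realType) (K : nat)
    (F : R -> set (set T)) : Prop :=
  [/\ forall t, 0 <= t <= K%:R -> sigma_algebra setT (F t),
      forall t, 0 <= t <= K%:R -> F t `<=` measurable
    & forall s t, 0 <= s -> s <= t -> t <= K%:R -> F s `<=` F t].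

(* When G is a sigma-algebra, the measurable sets of g_sigma_algebraType G are
   exactly the elements of G (sigma_algebra_id). *)
Definition L0 (T : pointedType) (R : realType) (G : set (set T)) :
    set (T -> R) :=
  [set f | measurable_fun setT (f : g_sigma_algebraType G -> R)].

Definition L0_nonneg (T : pointedType) (R : realType) (G : set (set T)) :
    set (T -> R) :=
  [set f | L0 G f /\ forall w, 0 <= f w].

Definition L0_nonpos (T : pointedType) (R : realType) (G : set (set T)) :
    set (T -> R) :=
  [set f | L0 G f /\ forall w, f w <= 0].

Section consumption.
Context d (T : measurableType d) (R : realType).
Implicit Types (K k n : nat) (F : R -> set (set T)) (S : R -> T -> R).
Implicit Types (X : nat -> T -> R) (psi : nat -> (T -> R) -> T -> R).
Implicit Types (psiK : T -> R).

Definition adapted K F S : Prop :=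
  forall t, 0 <= t <= K%:R -> L0 (F t) (S t).

Definition consumption_process K F X : Prop :=
  forall k, (k <= K)%N -> L0 (F k%:R) (X k).

(* account_upto S X n is the process A on the time interval [0, n]. *)
Fixpoint account_upto S X n (t : R) (w : T) : R :=
  if n is k.+1 then
    if t <= k%:R then account_upto S X k t w
    else (account_upto S X k k%:R w - X k w) * S t w / S k%:R w
  else S 0 w.

Definition account K S X : R -> T -> R := account_upto S X K.

Lemma account_upto_stable S X m n t w : (m <= n)%N -> t <= m%:R ->
  account_upto S X n t w = account_upto S X m t w.
Proof.
move=> + tm; elim: n => [|n IH]; first by rewrite leqn0 => /eqP ->.
rewrite leq_eqVlt => /predU1P[->//|]; rewrite ltnS => mn /=.
by rewrite ifT ?IH// (le_trans tm)// ler_nat.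
Qed.

Lemma account0 K S X w : account K S X 0 w = S 0 w.
Proof. exact: (@account_upto_stable S X 0). Qed.

Lemma accountS K S X k t w : (k < K)%N -> k%:R < t -> t <= k.+1%:R ->
  account K S X t w = (account K S X k%:R w - X k w) * S t w / S k%:R w.
Proof.
move=> kK kt tk; rewrite /account (account_upto_stable S X w kK tk) /=.
by rewrite leNgt kt /= (account_upto_stable S X w (ltnW kK) (lexx _)).
Qed.

Definition regular K S X : Prop :=
  forall k, (k <= K)%N -> forall w, 0 <= X k w <= account K S X k%:R w.

(* The operator psi_k is given by a total function on T -> R of which only the
   values on L0 (F k.+1%:R) are constrained. *)
Definition operator_family K F psi psiK : Prop :=
  [/\ forall k, (k < K)%N ->
        forall U, L0 (F k.+1%:R) U -> L0 (F k%:R) (psi k U),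
      forall k, (k < K)%N ->
        (forall U, L0_nonneg (F k.+1%:R) U -> L0_nonneg (F k%:R) (psi k U)) /\
        (forall U, L0_nonpos (F k.+1%:R) U -> L0_nonpos (F k%:R) (psi k U)),
      forall k, (k < K)%N ->
        forall U Y, L0 (F k.+1%:R) U -> L0_nonneg (F k%:R) Y ->
        psi k (fun w => Y w * U w) = (fun w => Y w * psi k U w)
    & L0_nonneg (F K%:R) psiK /\ forall w, psiK w <= 1].

(* The backward recursion is run forward in j = K - k. *)
Fixpoint Zrev K S psi psiK j : T -> R :=
  if j is i.+1 then
    let k := (K - i)%N in
    let p := psi k.-1 (fun w => Zrev K S psi psiK i w * S k%:R w) in
    fun w => p w / (S k.-1%:R w + p w)
  else psiK.

Definition Z K S psi psiK k : T -> R := Zrev K S psi psiK (K - k)%N.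

Lemma Z_last K S psi psiK : Z K S psi psiK K = psiK.
Proof. by rewrite /Z subnn. Qed.

Lemma Z_pred K S psi psiK k : (0 < k <= K)%N ->
  let p := psi k.-1 (fun w => Z K S psi psiK k w * S k%:R w) in
  Z K S psi psiK k.-1 = (fun w => p w / (S k.-1%:R w + p w)).
Proof.
case: k => // k /= kK; rewrite /Z /= -[in LHS](subnSK kK) /=.
by rewrite (subKn kK).
Qed.

End consumption.

(* Main.v *)
(* If X_(k+1) = Z_(k+1) A_(k+1)^+, then X_(k+1) = Y Z_(k+1) S_(k+1) with
   Y = (A_k - X_k)^+ / S_k non-negative and F_k-measurable, so that homogeneity
   gives X_k = Y psi_k(Z_(k+1) S_(k+1)); for X_k >= 0 this means
   X_k = Z_k A_k^+.  Taking positive parts is what allows the backward induction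
   to run before the sign of A is known; the bound Z <= 1 then shows forward in
   time that A >= 0.  In the other direction, X = Z A already forces A >= 0, and
   the same homogeneity argument applies without positive parts. *)
Require Import Defs.
From mathcomp Require Import measurable_realfun ring lra.

Set Implicit Arguments.
Unset Strict Implicit.
Unset Printing Implicit Defensive.

Local Open Scope classical_set_scope.
Local Open Scope ring_scope.

(** * Closure properties of the measurable functions *)

Section L0_theory.
Context (T : pointedType) (R : realType).
Implicit Types (G H : set (set T)) (f g : T -> R).

Lemma L0_mono G H f : G `<=` H -> L0 G f -> L0 H f.
Proof.
move=> GH mf mT B mB; apply: (sub_sigma_algebra2 GH).
exact: (mf measurableT B mB).
Qed.

Lemma L0B G f g : L0 G f -> L0 G g -> L0 G (fun w => f w - g w).
Proof. by move=> mf mg; exact: measurable_funB. Qed.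

Lemma L0D G f g : L0 G f -> L0 G g -> L0 G (fun w => f w + g w).
Proof. by move=> mf mg; exact: measurable_funD. Qed.

Lemma L0M G f g : L0 G f -> L0 G g -> L0 G (fun w => f w * g w).
Proof. by move=> mf mg; exact: measurable_funM. Qed.

Lemma L0_pos_part G f : L0 G f -> L0 G (fun w => Num.max (f w) 0).
Proof. by move=> mf; exact: measurable_maxr. Qed.

Lemma L0_div G f g : L0 G f -> L0 G g -> (forall w, 0 < g w) ->
  L0 G (fun w => f w / g w).
Proof.
move=> mf mg g0; apply: L0M => //.
(* The inverse is written as the real power with exponent -1, a measurable function; the two agree
   because [g] is positive. *)
have -> : (fun w => (g w)^-1) = (@powR R)^~ (-1) \o g.
  by apply/funext => w /=; rewrite powR_inv1// ltW.
by apply: measurableT_comp => //; exact: measurable_powR.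
Qed.

End L0_theory.

Section consumption_rate.
Context d (T : measurableType d) (R : realType) (K : nat).
Context (F : R -> set (set T)) (S : R -> T -> R).
Context (psi : nat -> (T -> R) -> T -> R) (psiK : T -> R).
Context (HF : filtration K F) (HS : adapted K F S).
Context (S_gt0 : forall t w, 0 <= t <= K%:R -> 0 < S t w).
Context (Hpsi : operator_family K F psi psiK).
Implicit Types (k : nat) (w : T) (X : nat -> T -> R).

Local Notation z := (Z K S psi psiK).
Local Notation A := (account K S).
Local Notation p k := (psi k (fun w => z k.+1 w * S k.+1%:R w)).

Lemma date_itv k : (k <= K)%N -> 0 <= (k%:R : R) <= K%:R.
Proof. by move=> kK; rewrite ler0n ler_nat. Qed.

Lemma S_date_gt0 k w : (k <= K)%N -> 0 < S k%:R w.
Proof. by move=> kK; exact/S_gt0/date_itv. Qed.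

Lemma L0_S k : (k <= K)%N -> L0 (F k%:R) (S k%:R).
Proof. by move=> kK; apply: HS; exact: date_itv. Qed.

Lemma L0_next k (f : T -> R) : (k < K)%N -> L0 (F k%:R) f -> L0 (F k.+1%:R) f.
Proof.
have [_ _ Fmono] := HF.
by move=> kK; apply: L0_mono; apply: Fmono; rewrite ?ler0n ?ler_nat.
Qed.

(** * Measurability and bounds of the consumption rate *)

Lemma Z_predE k w : (k < K)%N -> z k w = p k w / (S k%:R w + p k w).
Proof. by move=> kK; rewrite -[in LHS](succnK k) Z_pred. Qed.

(** With p >= 0 and S > 0 the quotient p / (S + p) lies between 0 and 1. Measurability is carried
    along in the same induction, since [psi] is known to preserve signs only on measurable
    arguments. *)
Lemma Z_L0_itv k : (k <= K)%N ->
  L0_nonneg (F k%:R) (z k) /\ forall w, z k w <= 1.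
Proof.
have [_ psi_sgn _ psiK01] := Hpsi.
(* The backward recursion becomes an ordinary induction on [K - k]. *)
move=> kK; rewrite -(subKn kK); elim: (K - k)%N (leq_subr k K) => [|j IH] jK.
  by rewrite subn0 Z_last.
have [[mz z0] z1] := IH (ltnW jK).
have lK : (K - j.+1 < K)%N by rewrite ltn_subrL (leq_ltn_trans _ jK).
rewrite -(subnSK jK) in mz z0 z1.
move: (K - j.+1)%N lK mz z0 z1 => l lK mz z0 z1.
have [mp p0] : L0_nonneg (F l%:R) (p l).
  apply: (psi_sgn l lK).1; split; first exact: L0M mz (L0_S lK).
  by move=> w; rewrite mulr_ge0// ltW// S_date_gt0.
have Sp w : 0 < S l%:R w + p l w by rewrite ltr_pwDl// S_date_gt0// ltnW.
have -> : z l = fun w => p l w / (S l%:R w + p l w).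
  by apply/funext => w; rewrite Z_predE.
split; first split.
- by apply: L0_div => //; exact: L0D (L0_S (ltnW lK)) mp.
- by move=> w; rewrite divr_ge0// ltW.
- by move=> w; rewrite ler_pdivrMr// mul1r lerDr ltW// S_date_gt0// ltnW.
Qed.

Lemma Z_ge0 k w : (k <= K)%N -> 0 <= z k w.
Proof. by case/Z_L0_itv => -[]. Qed.

Lemma Z_le1 k w : (k <= K)%N -> z k w <= 1.
Proof. by case/Z_L0_itv. Qed.

Lemma L0_Z k : (k <= K)%N -> L0 (F k%:R) (z k).
Proof. by case/Z_L0_itv => -[]. Qed.

Lemma L0_ZS k : (k <= K)%N -> L0 (F k%:R) (fun w => z k w * S k%:R w).
Proof. by move=> kK; exact: L0M (L0_Z kK) (L0_S kK). Qed.

Lemma psi_ZS_ge0 k w : (k < K)%N -> 0 <= p k w.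
Proof.
have [_ psi_sgn _ _] := Hpsi.
move=> kK; apply: ((psi_sgn k kK).1 _ _).2; split; first exact: L0_ZS.
by move=> v; rewrite mulr_ge0 ?Z_ge0// ltW// S_date_gt0.
Qed.

(** * Measurability and sign of the account *)

Lemma accountS_date X k w : (k < K)%N ->
  A X k.+1%:R w = (A X k%:R w - X k w) * S k.+1%:R w / S k%:R w.
Proof. by move=> kK; apply: accountS; rewrite ?ltr_nat. Qed.

Lemma L0_account X k : consumption_process K F X -> (k <= K)%N ->
  L0 (F k%:R) (A X k%:R).
Proof.
move=> mX; elim: k => [|k IH] kK; last have kK' := ltnW kK.
  have -> : A X 0%:R = S 0 by apply/funext => w; rewrite account0.
  exact: (L0_S kK).
have -> : A X k.+1%:R =
    fun w => (A X k%:R w - X k w) * S k.+1%:R w / S k%:R w.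
  by apply/funext => w; rewrite accountS_date.
apply: L0_div; last by move=> w; exact: S_date_gt0.
- apply: L0M (L0_S kK); apply: L0_next => //.
  by apply: L0B; [exact: IH|exact: mX].
- by apply: L0_next => //; exact: L0_S.
Qed.

(** Consuming at most the current account leaves a non-negative remainder, which the positive ratio
    of [S] only rescales. The bound is asked only where the account is non-negative, so that it can
    be checked for X = Z A^+ before the sign of A is known. *)
Lemma account_ge0 X : (forall k w, (k < K)%N -> 0 <= A X k%:R w ->
    X k w <= A X k%:R w) ->
  forall k w, (k <= K)%N -> 0 <= A X k%:R w.
Proof.
move=> XA; elim=> [|k IH] w kK; first by rewrite account0 ltW ?S_gt0 ?lexx/=.
have A0 := IH w (ltnW kK).
rewrite accountS_date// divr_ge0// ?mulr_ge0 ?subr_ge0 ?XA//; apply: ltW.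
- exact: S_date_gt0.
- by apply: S_date_gt0; exact: ltnW.
Qed.

Lemma ZA_account_ge0 X : (forall k w, (k < K)%N -> 0 <= A X k%:R w ->
    X k w = z k w * A X k%:R w) ->
  forall k w, (k <= K)%N -> 0 <= A X k%:R w.
Proof.
move=> XE; apply: account_ge0 => k w kK A0.
by rewrite XE// ler_piMl// Z_le1// ltnW.
Qed.

(** * Equivalence of the [psi]-recursion and X = Z A *)

Lemma psi_homogeneous k Y w : (k < K)%N -> L0_nonneg (F k%:R) Y ->
  psi k (fun v => Y v / S k%:R v * (z k.+1 v * S k.+1%:R v)) w =
  Y w / S k%:R w * p k w.
Proof.
have [_ _ psiM _] := Hpsi.
move=> kK [mY Y0]; have kK' := ltnW kK.
rewrite (psiM k kK _ (fun v => Y v / S k%:R v))//; first exact: L0_ZS.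
split=> [|v]; last by rewrite divr_ge0// ltW// S_date_gt0.
by apply: L0_div => //; [exact: L0_S|move=> v; exact: S_date_gt0].
Qed.

Lemma psi_recursion_pos_part X : consumption_process K F X ->
  (forall k, (k <= K)%N -> forall w, 0 <= X k w) ->
  (forall k, (k < K)%N -> forall w, X k w = psi k (X k.+1) w) ->
  (forall w, X K w = psiK w * A X K%:R w) ->
  forall k w, (k <= K)%N -> X k w = z k w * Num.max (A X k%:R w) 0.
Proof.
move=> mX X0 Xpsi XK k w kK; rewrite -(subKn kK).
elim: (K - k)%N (leq_subr k K) w => [|j IH] jK w.
  rewrite subn0 Z_last XK; have := X0 K (leqnn K) w; rewrite XK.
  have : 0 <= psiK w by have := Z_ge0 w (leqnn K); rewrite Z_last.
  (* If the final account is non-positive, [psiK] times it is both non-positive and, being X_K,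
     non-negative, hence zero. *)
  case: (leP (A X K%:R w) 0) => // A0 psi0 XK0; rewrite mulr0.
  by apply/eqP; rewrite eq_le XK0 mulr_ge0_le0.
have {}IH := IH (ltnW jK); rewrite -(subnSK jK) in IH.
have lK : (K - j.+1 < K)%N by rewrite ltn_subrL (leq_ltn_trans _ jK).
move: (K - j.+1)%N lK IH => l lK IH; have lK' := ltnW lK.
have S0 := S_date_gt0 w lK'; have p0 := psi_ZS_ge0 w lK.
have mY : L0_nonneg (F l%:R) (fun v => Num.max (A X l%:R v - X l v) 0).
  split; last by move=> v; rewrite le_max lexx orbT.
  by apply: L0_pos_part; apply: L0B; [exact: L0_account|exact: mX].
have XE : X l w = Num.max (A X l%:R w - X l w) 0 / S l%:R w * p l w.
  rewrite {1}Xpsi// -(psi_homogeneous w lK mY).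
  congr (psi l _ w); apply/funext => v.
  have Sl := S_date_gt0 v lK'; have Sl1 := S_date_gt0 v lK.
  rewrite IH accountS_date// -mulrA.
  (* Zero is written as a multiple of the positive ratio of [S], which then factors out of the
     maximum. *)
  rewrite -[X in Num.max _ X](mul0r (S l.+1%:R v / S l%:R v)).
  rewrite -maxr_pMl; last by rewrite divr_ge0// ltW.
  by ring.
have {}X0 := X0 l lK' w; rewrite Z_predE//.
have Sp : S l%:R w + p l w != 0 by rewrite gt_eqF// ltr_pwDl.
have S_neq0 : S l%:R w != 0 by rewrite gt_eqF.
(* When nothing is left after consumption, [XE] forces X_l = 0, so A_l <= 0 and both sides vanish.
   Otherwise A_l >= 0, and X S = (A - X) p is linear in X with solution p / (S + p) times A. *)
case: (leP (A X l%:R w - X l w) 0) XE => AX.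
  rewrite mul0r mul0r => Xl0; rewrite Xl0.
  by rewrite max_r ?mulr0//; move: AX; rewrite Xl0 subr0.
move=> XE; have A0 : 0 <= A X l%:R w by lra.
have XS : X l w * S l%:R w = (A X l%:R w - X l w) * p l w.
  by rewrite {1}XE; field.
by rewrite max_l// mulrAC; apply: (canRL (mulfK Sp)); lra.
Qed.

Lemma psi_recursion_ZA X : consumption_process K F X ->
  (forall k, (k <= K)%N -> forall w, 0 <= X k w) ->
  (forall k, (k < K)%N -> forall w, X k w = psi k (X k.+1) w) ->
  (forall w, X K w = psiK w * A X K%:R w) ->
  forall k w, (k <= K)%N -> X k w = z k w * A X k%:R w.
Proof.
move=> mX X0 Xpsi XK k w kK.
have XE := psi_recursion_pos_part mX X0 Xpsi XK.
rewrite XE// max_l//; apply: ZA_account_ge0 kK => l v lK A0.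
by rewrite XE ?max_l// ltnW.
Qed.

Lemma ZA_psi X k w : consumption_process K F X ->
  (forall k, (k <= K)%N -> forall w, X k w = z k w * A X k%:R w) ->
  (k < K)%N -> X k w = psi k (X k.+1) w.
Proof.
move=> mX XE kK; have kK' := ltnW kK.
have A0 l v : (l <= K)%N -> 0 <= A X l%:R v.
  by move=> lK; apply: ZA_account_ge0 lK => m u /ltnW mK _; exact: XE.
have -> : X k.+1 = fun v =>
    (A X k%:R v - X k v) / S k%:R v * (z k.+1 v * S k.+1%:R v).
  by apply/funext => v; rewrite XE// accountS_date//; ring.
rewrite (psi_homogeneous (Y := fun v => A X k%:R v - X k v))//; last first.
  split; first by apply: L0B; [exact: L0_account|exact: mX].
  by move=> v; rewrite subr_ge0 XE// ler_piMl ?A0 ?Z_le1.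
have S0 := S_date_gt0 w kK'; have p0 := psi_ZS_ge0 w kK.
(* What remains is z A = (A - z A) p / S for z = p / (S + p). *)
rewrite XE// Z_predE//; field.
by rewrite !gt_eqF// ltr_pwDl.
Qed.

(** * Existence and uniqueness of the process with X = Z A *)

Fixpoint ZA_account k : T -> R :=
  if k is l.+1 then
    fun w => (ZA_account l w - z l w * ZA_account l w) *
             S l.+1%:R w / S l%:R w
  else S 0.

Definition ZA_process k w := z k w * ZA_account k w.

(** Substituting X = Z A eliminates X from the account recursion. The account is thus determined by
    Z and S alone, which gives uniqueness. *)
Lemma account_ZA X : (forall k, (k <= K)%N -> forall w,
    X k w = z k w * A X k%:R w) ->
  forall k w, (k <= K)%N -> A X k%:R w = ZA_account k w.
Proof.
move=> XE; elim=> [|k IH] w kK; first by rewrite account0.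
by rewrite accountS_date// XE ?IH// ltnW.
Qed.

Lemma account_ZA_process k w : (k <= K)%N ->
  A ZA_process k%:R w = ZA_account k w.
Proof.
elim: k w => [|k IH] w kK; first by rewrite account0.
by rewrite accountS_date// IH// ltnW.
Qed.

Lemma ZA_process_consumption : consumption_process K F ZA_process.
Proof.
move=> k kK; apply: L0M (L0_Z kK) _.
elim: k kK => [|k IH] kK /=; first exact: (L0_S kK).
have kK' := ltnW kK.
apply: L0_div; last by move=> w; exact: S_date_gt0.
- apply: L0M (L0_S kK); apply: L0_next => //.
  by apply: L0B; [|apply: L0M (L0_Z kK') _]; exact: IH.
- by apply: L0_next => //; exact: L0_S.
Qed.

End consumption_rate.

Theorem theorem1 (d : measure_display) (T : measurableType d) (R : realType)
  (P : probability T R) (K : nat) (F : R -> set (set T)) (S : R -> T -> R)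
  (psi : nat -> (T -> R) -> T -> R) (psiK : T -> R) :
  filtration K F ->
  adapted K F S ->
  (forall t w, 0 <= t <= K%:R -> 0 < S t w) ->
  operator_family K F psi psiK ->
  (forall X : nat -> T -> R, consumption_process K F X ->
    ((forall k, (k <= K)%N -> forall w, 0 <= X k w) /\
     (forall k, (k < K)%N -> forall w, X k w = psi k (X k.+1) w) /\
     (forall w, X K w = psiK w * account K S X K%:R w))
    <->
    (forall k, (k <= K)%N -> forall w,
       X k w = Z K S psi psiK k w * account K S X k%:R w)) /\
  (exists X : nat -> T -> R,
    [/\ consumption_process K F X,
        forall k, (k <= K)%N -> forall w,
          X k w = Z K S psi psiK k w * account K S X k%:R w,
        forall X' : nat -> T -> R, consumption_process K F X' ->
          (forall k, (k <= K)%N -> forall w,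
             X' k w = Z K S psi psiK k w * account K S X' k%:R w) ->
          forall k, (k <= K)%N -> forall w, X' k w = X k w
      & regular K S X]).
Proof.
move=> HF HS S0 Hpsi; split=> [X mX|].
  split=> [[X0 [Xpsi XK]] k kK w|XE].
    exact: (psi_recursion_ZA HF HS S0 Hpsi).
  split=> [k kK w|].
    rewrite XE// mulr_ge0 ?(Z_ge0 HS S0 Hpsi)//.
    by apply: (ZA_account_ge0 HS S0 Hpsi _ w kK) => l v /ltnW lK _; exact: XE.
  split=> [k kK w|w]; first exact: (ZA_psi HF HS S0 Hpsi).
  by rewrite XE// Z_last.
pose X := ZA_process K S psi psiK.
have XE k : (k <= K)%N -> forall w,
    X k w = Z K S psi psiK k w * account K S X k%:R w.
  by move=> kK w; rewrite account_ZA_process.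
exists X; split=> //.
- exact: ZA_process_consumption.
- move=> X' _ XE' k kK w.
  (* Both accounts equal [ZA_account], so the two products with Z coincide. *)
  by rewrite XE' ?XE// (account_ZA XE')// (account_ZA XE).
- have A0 k w : (k <= K)%N -> 0 <= account K S X k%:R w.
    move=> kK.
    by apply: (ZA_account_ge0 HS S0 Hpsi _ w kK) => l v /ltnW lK _; exact: XE.
  move=> k kK w; rewrite XE// mulr_ge0 ?(Z_ge0 HS S0 Hpsi)//= ?A0//.
  by rewrite ler_piMl ?A0// (Z_le1 HS S0 Hpsi).
Qed.
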